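(* Let $(\mathfrak g,[\cdot,\cdot]_{\mathfrak g},s_{\mathfrak g})$ be a finite-dimensional Lie superalgebra over a field of characteristic $2$, and let $(\mathfrak g,c_{\mathfrak g},s_{\mathfrak g^*})$ be a Lie supercoalgebra structure on $\mathfrak g$. Let $c_{\mathfrak g^*}:\mathfrak g^*\to\mathfrak g^*\otimes\mathfrak g^*$ be the dual of the bracket $[\cdot,\cdot]_{\mathfrak g}$. Then the squaring $s_{\mathfrak g^*}$ satisfies $$s_{\mathfrak g^*}(f)\circ[\cdot,\cdot]_{\mathfrak g}=(f\otimes f)\circ(\mathrm{id}_{\mathfrak g}\otimes[\cdot,\cdot]_{\mathfrak g})\circ(c_{\mathfrak g}\otimes\mathrm{id}_{\mathfrak g}+\mathrm{id}_{\mathfrak g}\otimes c_{\mathfrak g})\quad\text{for all } f\in\mathfrak g^*_{\bar 1}$$ if and only if the map $c_{\mathfrak g^*}$ satisfies the squaring part of the $1$-cocycle condition, namely $$f\cdot c_{\mathfrak g^*}(f)+c_{\mathfrak g^*}(s_{\mathfrak g^*}(f))=0\quad\text{for all } f\in\mathfrak g^*_{\bar 1}.$$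
   Context: A Lie superalgebra in characteristic $2$ is a superspace $\mathfrak g=\mathfrak g_{\bar 0}\oplus\mathfrak g_{\bar 1}$ such that $\mathfrak g_{\bar 0}$ is a Lie algebra, $\mathfrak g_{\bar 1}$ is a $\mathfrak g_{\bar 0}$-module made two-sided by symmetry, together with a squaring $s_{\mathfrak g}:\mathfrak g_{\bar 1}\to\mathfrak g_{\bar 0}$ with $s_{\mathfrak g}(\lambda x)=\lambda^2 s_{\mathfrak g}(x)$ such that $[x,y]_{\mathfrak g}:=s_{\mathfrak g}(x+y)-s_{\mathfrak g}(x)-s_{\mathfrak g}(y)$ is bilinear on $\mathfrak g_{\bar 1}$ (this is the bracket of odd elements), and $[s_{\mathfrak g}(x),y]_{\mathfrak g}=[x,[x,y]_{\mathfrak g}]_{\mathfrak g}$ for all $x\in\mathfrak g_{\bar 1}$, $y\in\mathfrak g$. Lie supercoalgebra $(\mathfrak g,c_{\mathfrak g},s_{\mathfrak g^*})$: $c_{\mathfrak g}:\mathfrak g\to\mathfrak g\otimes\mathfrak g$ is an even linear map (the cobracket) whose dual $c_{\mathfrak g}^t:\mathfrak g^*\otimes\mathfrak g^*\to\mathfrak g^*$ satisfies $c_{\mathfrak g}^t(f\otimes f)=0$ for all $f\in\mathfrak g^*$, and which satisfies the co-Jacobi identity $(1+\xi+\xi^2)\circ(1\otimes c_{\mathfrak g})\circ c_{\mathfrak g}=0$ with $\xi(x\otimes y\otimes z)=y\otimes z\otimes x$; and $s_{\mathfrak g^*}:\mathfrak g^*_{\bar 1}\to\mathfrak g^*_{\bar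 0}$ is a squaring such that $(\mathfrak g^*,[\cdot,\cdot]_{\mathfrak g^*},s_{\mathfrak g^*})$ is a Lie superalgebra in characteristic $2$, where $\langle[f,h]_{\mathfrak g^*},x\rangle=\langle f\otimes h,c_{\mathfrak g}(x)\rangle$ and $\langle f\otimes h,x\otimes y\rangle=f(x)h(y)$. The map $c_{\mathfrak g^*}$ is defined by $\langle c_{\mathfrak g^*}(f),x\otimes y\rangle=f([x,y]_{\mathfrak g})$. The algebra $\mathfrak g^*$ acts on $\mathfrak g^*\otimes\mathfrak g^*$ by $f\cdot(a\otimes b)=[f,a]_{\mathfrak g^*}\otimes b+a\otimes[f,b]_{\mathfrak g^*}$.
   Formalization: The displayed identity is corrected: its second summand id⊗c is followed by the cyclic permutation ξ, so that x⊗y goes to y'⊗y''⊗x; taken literally, that summand contributes zero and the equivalence fails. *)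

(* Defs.v *)
From HB Require Import structures.
From mathcomp Require Import all_boot all_order all_algebra.

Set Implicit Arguments.
Unset Strict Implicit.
Unset Printing Implicit Defensive.

Import GRing.Theory.
Local Open Scope ring_scope.

Section Tensor.
Variable F : fieldType.
Implicit Types U V W : vectType F.

Definition bvec U (i : 'I_(\dim {: U})) : U := (vbasis {: U})`_i.
Definition bcoord U (i : 'I_(\dim {: U})) (u : U) : F :=
  coord (vbasis {: U}) i u.

(* U (x) V in coordinates: the entry (i, j) of a matrix is the coefficient of  *)
(* bvec i (x) bvec j.  The universal property is tliftE and tensor_ext.        *)
Definition tensor U V : vectType F := 'M[F]_(\dim {: U}, \dim {: V}).

Definition tens U V (u : U) (v : V) : tensor U V :=
  \matrix_(i, j) (bcoord i u * bcoord j v).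

Definition tlift_fun U V W (b : U -> V -> W) (t : tensor U V) : W :=
  \sum_i \sum_j
    (t : 'M_(_, _)) i j *: b (bvec i) (bvec j).

Fact tlift_fun_linear U V W (b : U -> V -> W) : linear (tlift_fun b).
Proof.
move=> k t t'; rewrite /tlift_fun scaler_sumr -big_split /=.
apply: eq_bigr => i _; rewrite scaler_sumr -big_split /=.
by apply: eq_bigr => j _; rewrite !mxE scalerDl scalerA.
Qed.

HB.instance Definition _ U V W (b : U -> V -> W) :=
  GRing.isLinear.Build F (tensor U V) W _ (tlift_fun b) (tlift_fun_linear b).

(* The linear map u (x) v |-> b u v; only meaningful for bilinear b. *)
Definition tlift U V W (b : U -> V -> W) : 'Hom(tensor U V, W) :=
  linfun (tlift_fun b).

Lemma bcoord_sum U (u : U) : u = \sum_i bcoord i u *: bvec i.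
Proof. exact: coord_vbasis (memvf u). Qed.

Lemma bcoord_bvec U (i j : 'I_(\dim {: U})) : bcoord j (bvec i) = (i == j)%:R.
Proof. exact: coord_free (basis_free (vbasisP _)). Qed.

Lemma bcoord_linear U i : linear (fun u : U => bcoord i u : F^o).
Proof. by move=> k x y; rewrite /bcoord linearP. Qed.

Lemma tliftE U V W (b : U -> V -> W) u v :
    (forall y, linear (b^~ y)) -> (forall x, linear (b x)) ->
  tlift b (tens u v) = b u v.
Proof.
move=> bl br; rewrite /tlift lfunE /= /tlift_fun.
pose Bl y := GRing.isLinear.Build F U W _ (b^~ y) (bl y).
pose Br x := GRing.isLinear.Build F V W _ (b x) (br x).
pose fl y : {linear U -> W} := HB.pack (b^~ y) (Bl y).
pose fr x : {linear V -> W} := HB.pack (b x) (Br x).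
rewrite [in RHS](bcoord_sum u) -[RHS]/(fl v _) linear_sum.
apply: eq_bigr => i _; rewrite linearZ /=.
rewrite [in RHS](bcoord_sum v) -[b _ _ in RHS]/(fr _ _) linear_sum scaler_sumr.
apply: eq_bigr => j _; rewrite linearZ /= scalerA; congr (_ *: _).
by rewrite mxE.
Qed.

Lemma tensDl U V (v : V) : linear (fun u : U => tens u v).
Proof. by move=> k x y; apply/matrixP => i j; rewrite !mxE bcoord_linear mulrDl -mulrA. Qed.

Lemma tensDr U V (u : U) : linear (fun v : V => tens u v).
Proof. by move=> k x y; apply/matrixP => i j; rewrite !mxE bcoord_linear mulrDr mulrCA. Qed.

Lemma tensor_sum U V (t : tensor U V) :
  t = \sum_i \sum_j (t : 'M_(_, _)) i j
        *: tens (bvec i) (bvec j).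
Proof.
rewrite [LHS]matrix_sum_delta; apply: eq_bigr => i _; apply: eq_bigr => j _.
congr (_ *: _); apply/matrixP => i' j'; rewrite !mxE !bcoord_bvec -natrM mulnb.
by rewrite (eq_sym i) (eq_sym j).
Qed.

Lemma tensor_ext U V W (f g : 'Hom(tensor U V, W)) :
  (forall u v, f (tens u v) = g (tens u v)) -> f = g.
Proof.
move=> fg; apply/lfunP => t; rewrite (tensor_sum t) !linear_sum.
apply: eq_bigr => i _; rewrite !linear_sum.
by apply: eq_bigr => j _; rewrite !linearZ /= fg.
Qed.

Definition tmap U V U' V' (f : 'Hom(U, U')) (g : 'Hom(V, V')) :
    'Hom(tensor U V, tensor U' V') :=
  tlift (fun u v => tens (f u) (g v)).

Lemma tmapE U V U' V' (f : 'Hom(U, U')) (g : 'Hom(V, V')) u v :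
  tmap f g (tens u v) = tens (f u) (g v).
Proof.
by apply: tliftE => ? k x y; rewrite linearP /= ?tensDl ?tensDr.
Qed.

Definition tassoc U V W :
    'Hom(tensor (tensor U V) W, tensor U (tensor V W)) :=
  tlift (fun t w => tlift (fun u v => tens u (tens v w)) t).

Definition txi U : 'Hom(tensor U (tensor U U), tensor U (tensor U U)) :=
  tlift (fun x t => tlift (fun y z => tens y (tens z x)) t).

Lemma tassocE U V W (u : U) (v : V) (w : W) :
  tassoc U V W (tens (tens u v) w) = tens u (tens v w).
Proof.
have E w' u' v' : tlift (fun u v => tens u (tens v w')) (tens u' v')
    = tens u' (tens v' w') :> tensor U (tensor V W).
  by apply: tliftE => ? k x y; rewrite ?tensDl ?tensDr.
rewrite /tassoc tliftE ?E // => [y k x z|x k y z]; first exact: linearP.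
pose h := k *: tlift (fun u v => tens u (tens v y))
          + tlift (fun u v => tens u (tens v z))
          : 'Hom(tensor U V, tensor U (tensor V W)).
transitivity (h x); last by rewrite /h !(add_lfunE, scale_lfunE).
congr (fun_of_lfun _ _); apply: tensor_ext => u' v'.
by rewrite /h !(add_lfunE, scale_lfunE) !E !tensDr.
Qed.

Lemma txiE U (x y z : U) :
  txi U (tens x (tens y z)) = tens y (tens z x).
Proof.
have E x' u' v' : tlift (fun y z => tens y (tens z x')) (tens u' v')
    = tens u' (tens v' x') :> tensor U (tensor U U).
  by apply: tliftE => ? k a b; rewrite ?tensDl ?tensDr.
rewrite /txi tliftE ?E // => [t k a b|a k t t']; last exact: linearP.
pose h := k *: tlift (fun y z => tens y (tens z a))
          + tlift (fun y z => tens y (tens z b))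
          : 'Hom(tensor U U, tensor U (tensor U U)).
transitivity (h t); last by rewrite /h !(add_lfunE, scale_lfunE).
congr (fun_of_lfun _ _); apply: tensor_ext => u' v'.
by rewrite /h !(add_lfunE, scale_lfunE) !E !tensDr.
Qed.

Definition tensv U V (A : {vspace U}) (B : {vspace V}) : {vspace tensor U V} :=
  <<[seq tens a b | a <- vbasis A, b <- vbasis B]>>%VS.

Lemma memv_tens U V (A : {vspace U}) (B : {vspace V}) u v :
  u \in A -> v \in B -> tens u v \in tensv A B.
Proof.
move=> /coord_vbasis-> /coord_vbasis->.
pose fl w : {linear U -> tensor U V} :=
  HB.pack (fun u => tens u w) (GRing.isLinear.Build F _ _ _ _ (tensDl w)).
pose fr w : {linear V -> tensor U V} :=
  HB.pack (fun v => tens w v) (GRing.isLinear.Build F _ _ _ _ (tensDr w)).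
rewrite -[tens _ _]/(fl _ _) linear_sum; apply: memv_suml => i _.
rewrite linearZ; apply: memvZ; rewrite /= -[tens _ _]/(fr _ _) linear_sum.
apply: memv_suml => j _; rewrite linearZ; apply: memvZ.
by apply/memv_span/allpairs_f; rewrite mem_nth ?size_tuple.
Qed.

Definition dual V : vectType F := 'Hom(V, F^o).

Definition tform U V (f : dual U) (h : dual V) : dual (tensor U V) :=
  tlift (fun x y => f x * h y : F^o).

Lemma tformE U V (f : dual U) (h : dual V) x y :
  tform f h (tens x y) = f x * h y.
Proof.
apply: tliftE => a k b c; rewrite linearP /=; first by rewrite mulrDl -scalerAl.
by rewrite mulrDr -scalerAr.
Qed.

(* <f (x) h, x (x) y> = f(x) h(y), as a map U* (x) V* -> (U (x) V)*. *)
Definition tpair U V : 'Hom(tensor (dual U) (dual V), dual (tensor U V)) :=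
  tlift (@tform U V).

Lemma tpairE U V (f : dual U) (h : dual V) :
  tpair U V (tens f h) = tform f h.
Proof.
apply: tliftE => a k b c; apply: tensor_ext => x y;
  rewrite !(add_lfunE, scale_lfunE) !tformE !lfun_simp.
  by rewrite mulrDl -scalerAl.
by rewrite mulrDr -scalerAr.
Qed.

Definition coordf V (i : 'I_(\dim {: V})) : dual V :=
  linfun (fun v : V => bcoord i v : F^o).

Lemma coordfE V i (v : V) : coordf i v = bcoord i v.
Proof.
pose f : {linear V -> F^o} := HB.pack (fun v : V => bcoord i v : F^o)
  (GRing.isLinear.Build F _ _ _ _ (@bcoord_linear V i)).
exact: (lfunE f).
Qed.

Lemma dim_dual V : \dim {: dual V} = \dim {: V}.
Proof. by rewrite !dimvf /dim /= muln1. Qed.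

Lemma dim_tensor U V :
  \dim {: tensor U V} = (\dim {: U} * \dim {: V})%N.
Proof. by rewrite dimvf. Qed.

Lemma tpair_lker0 U V : lker (tpair U V) == 0%VS.
Proof.
have surj : limg (tpair U V) = fullv.
  apply/eqP; rewrite eqEsubv subvf /=; apply/subvP => phi _.
  pose t : tensor (dual U) (dual V) := \sum_i \sum_j
     phi (tens (bvec i) (bvec j))
       *: tens (coordf i) (coordf j).
  suff -> : phi = tpair U V t by rewrite memv_img ?memvf.
  apply: tensor_ext => u v.
  have -> : tens u v = \sum_i \sum_j (bcoord i u * bcoord j v)
      *: tens (bvec i) (bvec j).
    rewrite [LHS]tensor_sum; apply: eq_bigr => i _; apply: eq_bigr => j _.
    by rewrite {1}/tens mxE.
  rewrite !linear_sum /=; apply: eq_bigr => i _.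
  rewrite !linear_sum /=; apply: eq_bigr => j _.
  rewrite !linearZ /=; congr (_ *: _).
  have tE k l : tpair U V (phi (tens (bvec k) (bvec l))
        *: tens (coordf k) (coordf l)) (tens (bvec i) (bvec j))
      = phi (tens (bvec k) (bvec l)) * ((i == k)%:R * (j == l)%:R).
    by rewrite linearZ scale_lfunE /= tpairE tformE !coordfE !bcoord_bvec.
  rewrite sum_lfunE (bigD1 i) //= [X in _ + X]big1 ?addr0 => [|k ki].
    rewrite linear_sum /= sum_lfunE (bigD1 j) //= [X in _ + X]big1 => [|l lj].
      by rewrite tE !eqxx !mulr1 addr0.
    by rewrite tE (eq_sym j) (negPf lj) !mulr0.
  rewrite linear_sum sum_lfunE big1 // => l _.
  by rewrite tE (eq_sym i) (negPf ki) mul0r mulr0.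
rewrite -dimv_eq0; have := limg_ker_dim (tpair U V) fullv.
rewrite capfv surj dim_dual !dim_tensor !dim_dual => /eqP.
by rewrite -[X in _ == X]add0n eqn_add2r.
Qed.

Lemma tpair_limg U V : limg (tpair U V) = fullv.
Proof.
apply/eqP; rewrite eqEdim subvf /=.
have /eqP k0 := tpair_lker0 U V.
rewrite limg_dim_eq ?k0 ?capv0 // dim_dual !dim_tensor.
by rewrite !dim_dual.
Qed.

Definition transpose U V (A : 'Hom(U, V)) : 'Hom(dual V, dual U) :=
  linfun (fun f : dual V => (f \o A)%VF : dual U).

Lemma transposeE U V (A : 'Hom(U, V)) f : transpose A f = (f \o A)%VF.
Proof.
have l : linear (fun f : dual V => (f \o A)%VF : dual U).
  by move=> k x y; rewrite comp_lfunDl comp_lfunZl.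
pose g : {linear dual V -> dual U} := HB.pack (fun f : dual V => (f \o A)%VF)
  (GRing.isLinear.Build F _ _ _ _ l).
exact: (lfunE g).
Qed.

(* The annihilator of A, as the kernel of f |-> f o (projection onto A). *)
Definition annv V (A : {vspace V}) : {vspace dual V} :=
  lker (transpose (projv A)).

Lemma annvP V (A : {vspace V}) (f : dual V) :
  reflect (forall x, x \in A -> f x = 0) (f \in annv A).
Proof.
rewrite memv_ker transposeE; apply: (iffP eqP) => [f0 x xA | f0].
  by rewrite -(projv_id xA) -comp_lfunE f0 lfunE.
by apply/lfunP => x; rewrite comp_lfunE f0 ?memv_proj // lfunE.
Qed.

End Tensor.

Section LieSuper.
Variables (F : fieldType) (g : vectType F).

(* Brackets and cobrackets are linear maps out of and into the tensor square. *)
(* A squaring is a total function whose values off the odd part are ignored.  *)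
Record is_lie_superalgebra (V : vectType F) (V0 V1 : {vspace V})
    (br : 'Hom(tensor V V, V)) (s : V -> V) : Prop := IsLieSuperalgebra {
  lsa_sum : (V0 + V1)%VS = fullv;
  lsa_direct : directv (V0 + V1);
  lsa_br00 : forall x y, x \in V0 -> y \in V0 -> br (tens x y) \in V0;
  lsa_alt : forall x, x \in V0 -> br (tens x x) = 0;
  lsa_jacobi : forall x y z, x \in V0 -> y \in V0 -> z \in V0 ->
    br (tens x (br (tens y z))) + br (tens y (br (tens z x)))
      + br (tens z (br (tens x y))) = 0;
  lsa_br01 : forall x y, x \in V0 -> y \in V1 -> br (tens x y) \in V1;
  lsa_module : forall x y z, x \in V0 -> y \in V0 -> z \in V1 ->
    br (tens (br (tens x y)) z) =
    br (tens x (br (tens y z))) - br (tens y (br (tens x z)));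
  lsa_sym : forall x y, x \in V0 -> y \in V1 ->
    br (tens y x) = br (tens x y);
  lsa_sqr : forall x, x \in V1 -> s x \in V0;
  lsa_sqrZ : forall k x, x \in V1 -> s (k *: x) = k ^+ 2 *: s x;
  lsa_polar : forall x y, x \in V1 -> y \in V1 ->
    br (tens x y) = s (x + y) - s x - s y;
  lsa_sqr_br : forall x y, x \in V1 ->
    br (tens (s x) y) = br (tens x (br (tens x y)))
}.

Definition dual_bracket (c : 'Hom(g, tensor g g)) :
    'Hom(tensor (dual g) (dual g), dual g) :=
  (transpose c \o tpair g g)%VF.

Lemma dual_bracketE (c : 'Hom(g, tensor g g)) (f h : dual g) x :
  dual_bracket c (tens f h) x = tpair g g (tens f h) (c x).
Proof. by rewrite comp_lfunE transposeE comp_lfunE. Qed.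

Definition dual_cobracket (br : 'Hom(tensor g g, g)) :
    'Hom(dual g, tensor (dual g) (dual g)) :=
  ((tpair g g)^-1 \o transpose br)%VF.

Lemma dual_cobracketE (br : 'Hom(tensor g g, g)) (f : dual g) x y :
  tpair g g (dual_cobracket br f) (tens x y) = f (br (tens x y)).
Proof.
by rewrite comp_lfunE limg_lfunVK ?tpair_limg ?memvf // transposeE comp_lfunE.
Qed.

Record is_lie_supercoalgebra (g0 g1 : {vspace g}) (c : 'Hom(g, tensor g g))
    (sd : dual g -> dual g) : Prop := IsLieSupercoalgebra {
  lsc_even0 : forall x, x \in g0 -> c x \in (tensv g0 g0 + tensv g1 g1)%VS;
  lsc_even1 : forall x, x \in g1 -> c x \in (tensv g0 g1 + tensv g1 g0)%VS;
  lsc_alt : forall f : dual g, dual_bracket c (tens f f) = 0;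
  lsc_cojacobi :
    ((\1 + txi g + (txi g \o txi g)) \o (tmap \1 c \o c))%VF = 0;
  (* (g* )_0 and (g* )_1 are the annihilators of g1 and g0, respectively. *)
  lsc_dual : is_lie_superalgebra (annv g1) (annv g0) (dual_bracket c) sd
}.

Definition ad (V : vectType F) (br : 'Hom(tensor V V, V)) (x : V) : 'Hom(V, V) :=
  linfun (fun y => br (tens x y)).

Lemma adE (V : vectType F) (br : 'Hom(tensor V V, V)) x y :
  ad br x y = br (tens x y).
Proof.
have l : linear (fun y => br (tens x y)).
  by move=> k a b; rewrite tensDr linearP.
pose h : {linear V -> V} := HB.pack (fun y => br (tens x y))
  (GRing.isLinear.Build F _ _ _ _ l).
exact: (lfunE h).
Qed.

Definition tensor_act (V : vectType F) (br : 'Hom(tensor V V, V)) (x : V) :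
    'Hom(tensor V V, tensor V V) :=
  tmap (ad br x) \1%VF + tmap \1%VF (ad br x).

End LieSuper.

(* Main.v *)
Require Import Defs.
From HB Require Import structures.
From mathcomp Require Import all_boot all_order all_algebra.

Import GRing.Theory.
Local Open Scope ring_scope.

(** Both conditions are equalities between bilinear forms on [g], and for each
    odd [f] they are the same equality.  Write [A] for the endomorphism
    [(f (x) id) o c] of [g], so that [A x = f(x') x''] if [c x = x' (x) x''].
    By definition of the bracket of the dual, [ad f] is the transpose of [A]
    ([ad_dual_bracket]).  Since the form [f([x, y])] represents the dual
    cobracket of [f], the derivation action of [f] on that cobracket is
    represented by [f([A x, y]) + f([x, A y])] ([tpair_tensor_act]).

    The right-hand side of the squaring identity, evaluated at [x (x) y], is
    [f(x') f([x'', y]) + f(y') f([y'', x])], that is,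
    [f([A x, y]) + f([A y, x])] ([contract_cobracket_left] and
    [contract_cobracket_right]).  In characteristic 2 the bracket of a Lie
    superalgebra is symmetric on the whole space ([lie_superalgebra_symm]), so
    the two forms coincide; and there [a + b = 0] means [a = b].  As the pairing
    between the tensor square of the dual and the dual of the tensor square is
    injective, comparing forms loses nothing. *)

Section Contraction.
Context {F : fieldType}.
Implicit Types U V W : vectType F.

(** For expressions that depend linearly on a tensor without being given as an
    element of a space of homomorphisms. *)
Lemma linear_tensor_ext {U V W} (p q : tensor U V -> W) :
  linear p -> linear q -> (forall u v, p (tens u v) = q (tens u v)) -> p =1 q.
Proof.
move=> lp lq pq t.
pose P : {linear tensor U V -> W} :=
  HB.pack p (GRing.isLinear.Build F _ _ _ _ lp).
pose Q : {linear tensor U V -> W} :=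
  HB.pack q (GRing.isLinear.Build F _ _ _ _ lq).
have PQ : linfun P = linfun Q by apply: tensor_ext => u v; rewrite !lfunE /= pq.
by move/lfunP: PQ => /(_ t); rewrite !lfunE.
Qed.

Lemma tpair_inj {U V} : injective (tpair U V).
Proof. exact/lker0P/tpair_lker0. Qed.

Lemma tpair_tmap_transpose {U V} (A : 'Hom(U, U)) (B : 'Hom(V, V)) t x y :
  tpair U V (tmap (transpose A) (transpose B) t) (tens x y)
  = tpair U V t (tens (A x) (B y)).
Proof.
apply: (linear_tensor_ext (W := F^o)
  (fun t => tpair U V (tmap (transpose A) (transpose B) t) (tens x y))
  (fun t => tpair U V t (tens (A x) (B y)))) => [k t1 t2|k t1 t2|a b].
- by rewrite !linearP add_lfunE scale_lfunE.
- by rewrite !linearP add_lfunE scale_lfunE.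
by rewrite tmapE !tpairE !tformE !transposeE !comp_lfunE.
Qed.

Lemma transpose_id V : transpose (\1%VF : 'End(V)) = \1%VF.
Proof. by apply/lfunP => f; rewrite transposeE comp_lfun1r lfunE. Qed.

Definition contract_left {U V} (f : dual U) : 'Hom(tensor U V, V) :=
  tlift (fun u v => f u *: v).

Lemma contract_leftE {U V} (f : dual U) u (v : V) :
  contract_left f (tens u v) = f u *: v.
Proof.
apply: tliftE => [y k a b|x k a b]; first by rewrite linearP /= scalerDl scalerA.
by rewrite scalerDr !scalerA mulrC.
Qed.

Lemma apply_contract_left {U V} (f : dual U) (h : dual V) t :
  h (contract_left f t) = tpair U V (tens f h) t.
Proof.
rewrite -comp_lfunE; congr (fun_of_lfun _ t); apply: tensor_ext => u v.
by rewrite comp_lfunE contract_leftE linearZ /= tpairE tformE.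
Qed.

End Contraction.

Section DualAction.
Context {F : fieldType} {g : vectType F}.
Variables (br : 'Hom(tensor g g, g)) (c : 'Hom(g, tensor g g)).
Implicit Types (f : dual g) (x y : g).

(** The bracket of the dual is [[f, h] = (f (x) h) o c], in which [f] can be
    applied first, leaving [h] composed with an endomorphism of [g]. *)
Lemma ad_dual_bracket f :
  ad (dual_bracket c) f = transpose (contract_left f \o c)%VF.
Proof.
apply/lfunP => h; apply/lfunP => x.
by rewrite adE dual_bracketE transposeE !comp_lfunE apply_contract_left.
Qed.

(** The derivation action of [f] is [ad f (x) id + id (x) ad f], and each [ad f]
    moves across the pairing to its transpose. *)
Lemma tpair_tensor_act f t x y :
  tpair g g (tensor_act (dual_bracket c) f t) (tens x y)
  = tpair g g t (tens (contract_left f (c x)) y)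
    + tpair g g t (tens x (contract_left f (c y))).
Proof.
rewrite /tensor_act ad_dual_bracket -transpose_id add_lfunE linearD add_lfunE /=.
by rewrite !tpair_tmap_transpose !comp_lfunE !id_lfunE.
Qed.

(** On [t = u (x) v] both sides are [f(u) f([v, y])], so the sum over the legs
    of a cobracket becomes a single value of [f] on the bracket. *)
Lemma tform_tassoc f t y :
  tform f f (tmap \1 br (tassoc g g g (tens t y)))
  = f (br (tens (contract_left f t) y)).
Proof.
apply: (linear_tensor_ext (W := F^o)
  (fun t => tform f f (tmap \1 br (tassoc g g g (tens t y))))
  (fun t => f (br (tens (contract_left f t) y)))) => [k a b|k a b|u v].
- by rewrite tensDl !linearP.
- by rewrite linearP tensDl !linearP.
rewrite tassocE tmapE tformE id_lfunE contract_leftE.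
have := tensDl y (f u) v 0; rewrite addr0 => ->.
have -> : tens (0 : g) y = 0.
  by have := tensDl y (-1) (0 : g) 0; rewrite scaler0 addr0 scaleN1r addNr.
by rewrite addr0 !linearZ.
Qed.

(** The cyclic permutation sends [x (x) t] to the reassociation of [t (x) x], so
    the second summand of the squaring identity is the first with the arguments
    exchanged. *)
Lemma tform_txi f x t :
  tform f f (tmap \1 br (txi g (tens x t)))
  = f (br (tens (contract_left f t) x)).
Proof.
rewrite -tform_tassoc.
apply: (linear_tensor_ext (W := F^o)
  (fun t => tform f f (tmap \1 br (txi g (tens x t))))
  (fun t => tform f f (tmap \1 br (tassoc g g g (tens t x)))))
  => [k a b|k a b|u v].
- by rewrite tensDr !linearP.
- by rewrite tensDl !linearP.
by rewrite txiE tassocE.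
Qed.

Lemma contract_cobracket_left f x y :
  (tform f f \o (tmap \1 br \o (tassoc g g g \o tmap c \1)))%VF (tens x y)
  = f (br (tens (contract_left f (c x)) y)).
Proof. by rewrite !comp_lfunE tmapE id_lfunE tform_tassoc. Qed.

Lemma contract_cobracket_right f x y :
  (tform f f \o (tmap \1 br \o (txi g \o tmap \1 c)))%VF (tens x y)
  = f (br (tens (contract_left f (c y)) x)).
Proof. by rewrite !comp_lfunE tmapE id_lfunE tform_txi. Qed.

(** On the even part symmetry is the polarization of the alternating law, where
    the sign disappears in characteristic 2; on the odd part the bracket is the
    polar form of the squaring; mixed brackets are symmetric by convention. *)
Lemma lie_superalgebra_symm {g0 g1 : {vspace g}} {s : g -> g} :
    2%N \in [pchar F] -> is_lie_superalgebra g0 g1 br s ->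
  forall x y, br (tens x y) = br (tens y x).
Proof.
move=> char2 hg.
have brDl x x' y : br (tens (x + x') y) = br (tens x y) + br (tens x' y).
  by have := tensDl y 1 x x'; rewrite !scale1r => ->; rewrite linearD.
have brDr x y y' : br (tens x (y + y')) = br (tens x y) + br (tens x y').
  by have := tensDr x 1 y y'; rewrite !scale1r => ->; rewrite linearD.
have opp (v : g) : - v = v.
  by rewrite -scaleN1r oppr_pchar2 ?scale1r.
have even x y : x \in g0 -> y \in g0 -> br (tens x y) = br (tens y x).
  move=> x0 y0; have := lsa_alt hg (memvD x0 y0).
  rewrite brDl !brDr !(lsa_alt hg) // addr0 add0r => /eqP.
  by rewrite addr_eq0 opp => /eqP.
have odd x y : x \in g1 -> y \in g1 -> br (tens x y) = br (tens y x).
  by move=> x1 y1; rewrite !(lsa_polar hg) // addrAC [x + y]addrC.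
have sum z : z \in (g0 + g1)%VS by rewrite (lsa_sum hg) memvf.
move=> x y.
have /memv_addP[x0 x0P [x1 x1P ->]] := sum x.
have /memv_addP[y0 y0P [y1 y1P ->]] := sum y.
rewrite !brDl !brDr (even x0 y0) // (odd x1 y1) //.
by rewrite (lsa_sym hg y0P x1P) (lsa_sym hg x0P y1P) addrACA.
Qed.

End DualAction.

(* id (x) c sends x (x) y to x (x) y' (x) y''.  For the leg of c to meet x in  *)
(* the bracket, as in the cocycle condition, it is read up to the cyclic       *)
(* permutation txi: x (x) y |-> y' (x) y'' (x) x.  Without it the second       *)
(* summand f(x) f([y', y'']) vanishes identically, c being alternating and the *)
(* bracket symmetric, and the equivalence fails.                               *)
Theorem proposition3p4p5 (F : fieldType) (char2 : 2%N \in [pchar F])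
    (g : vectType F) (g0 g1 : {vspace g})
    (br : 'Hom(tensor g g, g)) (s : g -> g)
    (c : 'Hom(g, tensor g g)) (sd : dual g -> dual g)
    (hg : is_lie_superalgebra g0 g1 br s)
    (hc : is_lie_supercoalgebra g0 g1 c sd) :
  (forall f : dual g, f \in annv g0 ->
     (sd f \o br)%VF =
     (tform f f \o (tmap \1 br \o
        ((tassoc g g g \o tmap c \1) + (txi g \o tmap \1 c))))%VF)
  <->
  (forall f : dual g, f \in annv g0 ->
     tensor_act (dual_bracket c) f (dual_cobracket br f)
       + dual_cobracket br (sd f) = 0).
Proof.
have rhsE f : (tform f f \o (tmap \1 br \o
    ((tassoc g g g \o tmap c \1) + (txi g \o tmap \1 c))))%VF
    = tpair g g (tensor_act (dual_bracket c) f (dual_cobracket br f)).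
  apply: tensor_ext => x y; rewrite tpair_tensor_act !dual_cobracketE.
  rewrite !comp_lfunDr add_lfunE contract_cobracket_left contract_cobracket_right.
  by rewrite (lie_superalgebra_symm br char2 hg x).
have lhsE f : (sd f \o br)%VF = tpair g g (dual_cobracket br (sd f)).
  by apply: tensor_ext => x y; rewrite dual_cobracketE comp_lfunE.
have add_eq0 (a b : tensor (dual g) (dual g)) : a + b = 0 <-> a = b.
  have -> : a + b = a - b by rewrite -[- b]scaleN1r oppr_pchar2 ?scale1r.
  by split=> [/subr0_eq|->]; rewrite ?subrr.
split=> H f /H; first by rewrite rhsE lhsE => /tpair_inj ->; apply/add_eq0.
by rewrite rhsE lhsE => /add_eq0 ->.
Qed.
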